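(* Let $$T_n(x)=\frac{a_0}{2}+\sum_{l=1}^{n}\bigl(a_l\cos lx+b_l\sin lx\bigr)$$ be a trigonometric polynomial with real coefficients in which at least one of the leading coefficients $a_n$, $b_n$ is not zero, and suppose that $T_n$ has distinct real roots $x_1,\ldots,x_m$, $m\ge 2$, with multiplicities $\alpha_1,\ldots,\alpha_m$ respectively, $\alpha_1+\ldots+\alpha_m=2n$. Put $d=\min_{i\neq j}|x_i-x_j|$. Let $c$, $q$ and $\xi$ be positive real numbers such that $q<1$, $2c<\xi$, $d-2c>0$ and $\max_{i\neq j}|x_i-x_j|<2\pi-2\xi$. Put $$A=\min\left\{\left|\sin\frac{\xi}{2}\right|,\ \left|\sin\left(\frac{d}{2}-c\right)\right|\right\}$$ and suppose that $$c^2\left(4n+\alpha_i\left(\frac{9A^2}{8}-2\right)\right)<A^2\alpha_i,\qquad i=1,\ldots,m.$$ Let the sequences $x_i^{[k]}$, $i=1,\ldots,m$, $k=0,1,2,\ldots$, be generated from initial approximations $x_1^{[0]},\ldots,x_m^{[0]}$ by $$x_i^{[k+1]}=x_i^{[k]}-\alpha_i T_n\bigl(x_i^{[k]}\bigr)\left[T_n'\bigl(x_i^{[k]}\bigr)-T_n\bigl(x_i^{[k]}\bigr)\frac{Q_i'\bigl(x_i^{[k]}\bigr)}{Q_i\bigl(x_i^{[k]}\bigr)}\right]^{-1},\qquad i=1,\ldots,m,\ k=0,1,2,\ldots,$$ where, at step $k$, $Q_i(x)=\prod_{j\neq i,\,j=1}^{m}\sin^{\alpha_j}\left(\frac{x-x_j^{[k]}}{2}\right)$.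 If the initial approximations satisfy $|x_i^{[0]}-x_i|\le cq$ for $i=1,\ldots,m$, then for every natural number $k$ the inequalities $$|x_i^{[k]}-x_i|\le c\,q^{3^k},\qquad i=1,\ldots,m,$$ hold.
   Context: The iteration is a method for simultaneously approximating all roots of $T_n$ when their multiplicities $\alpha_i$ (positive integers) are known. The function $Q_i$ depends on the iteration number $k$ through the current approximations $x_j^{[k]}$, and $Q_i'$ denotes its derivative with respect to $x$. *)

(* Defs.v *)
From HB Require Import structures.
From mathcomp Require Import all_boot all_order all_algebra.
From mathcomp Require Import all_classical all_reals all_analysis.
Set Implicit Arguments.
Unset Strict Implicit.
Unset Printing Implicit Defensive.
Import Order.TTheory GRing.Theory Num.Theory.
Import numFieldNormedType.Exports.
Local Open Scope classical_set_scope.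
Local Open Scope ring_scope.

Definition trigpoly (R : realType) (n : nat) (a b : nat -> R) (x : R) : R :=
  a 0%N / 2 + \sum_(1 <= l < n.+1) (a l * cos (l%:R * x) + b l * sin (l%:R * x)).

Definition root_of_mult (R : realType) (f : R -> R) (r : R) (mu : nat) : Prop :=
  [/\ (0 < mu)%N, forall j : nat, (j < mu)%N -> derive1n j f r = 0 & derive1n mu f r <> 0].

(* Distances are nonnegative, so starting the maximum at 0 does not alter it
   once there are at least two points. *)
Definition max_dist (R : realType) (m : nat) (x : 'I_m -> R) : R :=
  \big[Num.max/0]_(p : 'I_m * 'I_m | p.1 != p.2) `|x p.1 - x p.2|.

(* The starting value max_dist x bounds every term from above, so this is the
   true minimum once there are at least two points. *)
Definition min_dist (R : realType) (m : nat) (x : 'I_m -> R) : R :=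
  \big[Num.min/max_dist x]_(p : 'I_m * 'I_m | p.1 != p.2) `|x p.1 - x p.2|.

Definition Qfun (R : realType) (m : nat) (alpha : 'I_m -> nat) (y : 'I_m -> R)
    (i : 'I_m) (x : R) : R :=
  \prod_(j < m | j != i) sin ((x - y j) / 2) ^+ alpha j.

(* Inversion is total with 0^-1 = 0: at an exact multiple root of T the numerator
   and the bracket both vanish, and the step leaves the approximation in place. *)
Definition iter_step (R : realType) (m : nat) (T : R -> R)
    (alpha : 'I_m -> nat) (y : 'I_m -> R) (i : 'I_m) : R :=
  y i - (alpha i)%:R * T (y i) *
    (derive1 T (y i) - T (y i) * (derive1 (Qfun alpha y i) (y i) / Qfun alpha y i (y i)))^-1.

(* Main.v *)
(* A homogeneous form of degree [N + 1] in [cos (x / 2)] and [sin (x / 2)] that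
   vanishes at [r] is [sin ((x - r) / 2)] times a form of degree [N].  Peeling
   off the [2 n] roots of the trigonometric polynomial [T] one at a time gives
   [T x = K * prod_j sin ((x - r_j) / 2) ^ alpha_j] with [K] constant, so [T' / T]
   is a sum of half-angle cotangents.  For an approximation with error [e] at
   the root [r_i], the error after one step is therefore
     (alpha_i (e cos (e / 2) - 2 sin (e / 2)) + e S sin (e / 2))
       / (alpha_i cos (e / 2) + S sin (e / 2)),
   where [S] collects differences of cotangents at the roots and at their
   approximations, hence is of the order of the largest error; the numerator is
   of third order. *)
Require Import Defs.
From HB Require Import structures.
From mathcomp Require Import all_boot all_order all_algebra.
From mathcomp Require Import all_classical all_reals all_analysis.
From mathcomp Require Import ring lra zify.
Set Implicit Arguments.
Unset Strict Implicit.
Unset Printing Implicit Defensive.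
Import Order.TTheory GRing.Theory Num.Theory.
Import numFieldNormedType.Exports.
Local Open Scope classical_set_scope.
Local Open Scope ring_scope.

(** * Elementary bounds for sine and cosine, and the estimate of the one-step error *)

Lemma nonneg_of_derive (R : realType) (f df : R -> R) (x : R) :
  (forall y : R, is_derive y 1 f (df y)) -> f 0 = 0 ->
  (forall y, 0 <= y -> 0 <= df y) -> 0 <= x -> 0 <= f x.
Proof.
move=> fdf f0 df0 x0.
have [|y] := MVT_segment x0 (fun y _ => fdf y).
  apply: derivable_within_continuous => y _.
  by have := fdf y; move=> [].
rewrite in_itv /= => /andP[y0 _]; rewrite f0 !subr0 => ->.
by rewrite mulr_ge0 ?df0.
Qed.

Lemma norm_sin_le (R : realType) (x : R) : `|sin x| <= `|x|.
Proof.
have pos (y : R) : 0 <= y -> `|sin y| <= y.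
  move=> y0; rewrite ler_norml; apply/andP; split.
    rewrite -subr_ge0.
    apply: (@nonneg_of_derive R (fun y => sin y - - y) (fun y => cos y - - 1)) => //.
    by rewrite sin0; ring.
  rewrite -subr_ge0.
  apply: (@nonneg_of_derive R (fun y => y - sin y) (fun y => 1 - cos y)) => //.
  by rewrite sin0; ring.
have [x0|x0] := leP 0 x; first by rewrite (ger0_norm x0) pos.
by rewrite (ltr0_norm x0) -normrN -sinN pos // oppr_ge0 ltW.
Qed.

Lemma cos_ge_quad (R : realType) (x : R) : 1 - x ^+ 2 / 2 <= cos x.
Proof.
have pos (y : R) : 0 <= y -> 1 - y ^+ 2 / 2 <= cos y.
  move=> y0; rewrite -subr_ge0.
  apply: (@nonneg_of_derive R (fun y => cos y - (1 - y ^+ 2 / 2))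
    (fun y => y - sin y)) => //.
  - move=> z; apply: is_derive_eq.
    by rewrite /GRing.scale /=; field.
  - by rewrite cos0; ring.
  - move=> z z0; have := norm_sin_le z; rewrite (ger0_norm z0) ler_norml.
    by move=> /andP[]; lra.
have [/pos //|x0] := leP 0 x.
by rewrite -cosN -(sqrrN x) pos // oppr_ge0 ltW.
Qed.

(** The derivative of [sin y - y * cos y] is [y * sin y], which lies between [- y ^+ 2] and
    [y ^+ 2]; integrating from 0 gives the cubic bound. This is the source of the third order of the
    method. *)
Lemma norm_sinBcos_le (R : realType) (x : R) :
  `|sin x - x * cos x| <= `|x| ^+ 3 / 3.
Proof.
have pos (y : R) : 0 <= y -> `|sin y - y * cos y| <= y ^+ 3 / 3.
  have sgl (z : R) : 0 <= z -> - z ^+ 2 <= z * sin z <= z ^+ 2.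
    move=> z0; have := norm_sin_le z; rewrite (ger0_norm z0) ler_norml.
    by move=> /andP[]; nra.
  move=> y0; rewrite ler_norml; apply/andP; split; rewrite -subr_ge0.
    apply: (@nonneg_of_derive R (fun y => sin y - y * cos y - - (y ^+ 3 / 3))
      (fun y => y * sin y + y ^+ 2)) => //.
    - move=> z; apply: is_derive_eq.
      by rewrite /GRing.scale /=; field.
    - by rewrite sin0; ring.
    - by move=> z /sgl /andP[]; lra.
  apply: (@nonneg_of_derive R (fun y => y ^+ 3 / 3 - (sin y - y * cos y))
    (fun y => y ^+ 2 - y * sin y)) => //.
  - move=> z; apply: is_derive_eq.
    by rewrite /GRing.scale /=; field.
  - by rewrite sin0; ring.
  - by move=> z /sgl /andP[]; lra.
have [x0|x0] := leP 0 x; first by rewrite (ger0_norm x0) pos.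
rewrite (ltr0_norm x0) -normrN.
have -> : - (sin x - x * cos x) = sin (- x) - (- x) * cos (- x).
  by rewrite sinN cosN; ring.
by rewrite pos // oppr_ge0 ltW.
Qed.

(** Sine increases up to [pi / 2], so [sin p] is a lower bound there; beyond it, the reflection
    [t -> pi - t] leads back to the increasing branch with bound [sin q]. *)
Lemma sin_ge_min (R : realType) (p q t : R) :
  0 < p -> 0 < q -> p <= t <= pi - q -> Num.min (sin p) (sin q) <= sin t.
Proof.
have mono (u v : R) : 0 < u -> u <= v -> v <= pi / 2 -> sin u <= sin v.
  move=> u0 uv vpi; rewrite leNgt ltr_sin ?in_itv /= -?leNgt //.
  - by apply/andP; split; lra.
  - by apply/andP; split; lra.
move=> p0 q0 /andP[pt tq]; rewrite ge_min.
have [tpi|tpi] := leP t (pi / 2); first by rewrite mono.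
have -> : sin t = sin (pi - t) by rewrite sinB sinpi cospi; ring.
by rewrite (mono q) ?orbT //; lra.
Qed.

(* With [sn = sin (e / 2)] and [cs = cos (e / 2)], the quotient bounded here is
   the error after one step. *)
Lemma step_error_le (R : realType) (A c E e al nu S sn cs : R) :
  0 < A -> 0 < c -> 0 < al -> 0 <= nu -> `|e| <= E -> E <= c ->
  `|S| * (2 * A ^+ 2) <= nu * E ->
  c ^+ 2 * (2 * nu + 9 / 8 * al * A ^+ 2) < A ^+ 2 * al ->
  `|sn| <= `|e| / 2 -> 1 - e ^+ 2 / 8 <= cs ->
  `|e * cs - 2 * sn| <= `|e| ^+ 3 / 12 ->
  0 < al * cs + S * sn /\
  `|(al * (e * cs - 2 * sn) + e * S * sn) / (al * cs + S * sn)|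
    <= E ^+ 3 / c ^+ 2.
Proof.
move=> A0 c0 al0 nu0 eE Ec hS hcond hsn hcs hnum.
have e0 : 0 <= `|e| by [].
have E0 : 0 <= E by apply: le_trans eE.
have A2 : 0 < A ^+ 2 by rewrite exprn_gt0.
have c2 : 0 < c ^+ 2 by rewrite exprn_gt0.
have E2c2 : E ^+ 2 <= c ^+ 2 by rewrite lerXn2r // nnegrE // ltW.
have e2E2 : e ^+ 2 <= E ^+ 2.
  by rewrite -(real_normK (num_real e)) lerXn2r // nnegrE.
have e3E3 : `|e| ^+ 3 <= E ^+ 3 by rewrite lerXn2r // nnegrE.
have hsnE : `|sn| <= E / 2 by apply: le_trans hsn _; lra.
pose s := nu * E / (2 * A ^+ 2).
have s0 : 0 <= s by rewrite divr_ge0 ?mulr_ge0 // ltW // exprn_gt0.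
have hSs : `|S| <= s by rewrite ler_pdivlMr // mulr_gt0.
(* With [s] bounding [S] and [E / 2] bounding [sn], [w] is the coefficient in the bound [w * E ^+ 2]
   of their product. Dividing the hypothesis by [A ^+ 2] expresses it through [w] alone. *)
pose w := nu / (4 * A ^+ 2).
have w0 : 0 <= w by rewrite divr_ge0 ?mulr_ge0 // ltW.
have sE : s * (E / 2) = w * E ^+ 2 by rewrite /s /w; field; rewrite gt_eqF.
have hSsn : `|S * sn| <= w * E ^+ 2 by rewrite normrM -sE ler_pM.
have wcond : c ^+ 2 * (8 * w + 9 / 8 * al) < al.
  have -> : c ^+ 2 * (8 * w + 9 / 8 * al) =
      c ^+ 2 * (2 * nu + 9 / 8 * al * A ^+ 2) / A ^+ 2.
    by rewrite /w; field; rewrite gt_eqF.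
  by rewrite ltr_pdivrMr // (mulrC al).
have alcs : al * (1 - E ^+ 2 / 8) <= al * cs.
  by rewrite ler_wpM2l ?(ltW al0) //; apply: le_trans hcs; lra.
have SsnN : - (w * E ^+ 2) <= S * sn.
  by move: hSsn; rewrite ler_norml => /andP[].
have wE : w * E ^+ 2 <= w * c ^+ 2 by rewrite ler_wpM2l.
have alE : al * E ^+ 2 <= al * c ^+ 2 by rewrite ler_wpM2l // ltW.
have wc0 : 0 <= w * c ^+ 2 by rewrite mulr_ge0 // ltW.
have alc0 : 0 < al * c ^+ 2 by rewrite mulr_gt0.
have den : al - al * c ^+ 2 / 8 - w * c ^+ 2 <= al * cs + S * sn by lra.
have den0 : 0 < al * cs + S * sn by apply: lt_le_trans den; lra.
split=> //.
rewrite normrM normfV (gtr0_norm den0) ler_pdivrMr //.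
have E3 : 0 <= E ^+ 3 by rewrite exprn_ge0.
have num : `|al * (e * cs - 2 * sn) + e * S * sn| <= E ^+ 3 * (al / 12 + w).
  apply: le_trans (ler_normD _ _) _.
  have -> : E ^+ 3 * (al / 12 + w) = al * (E ^+ 3 / 12) + E * (w * E ^+ 2).
    by ring.
  apply: lerD.
    rewrite normrM (gtr0_norm al0) ler_wpM2l ?(ltW al0) //.
    by apply: le_trans hnum _; lra.
  by rewrite -mulrA normrM ler_pM.
apply: le_trans num _.
(* Cancelling [E ^+ 3] leaves [(al / 12 + w) * c ^+ 2] to be bounded by the denominator, which
   follows from its lower bound [den] and from [wcond]. *)
rewrite -[leRHS]mulrA ler_wpM2l // [leRHS]mulrC ler_pdivlMr //.
by apply: le_trans den; lra.
Qed.

(** * Functions generated by the half-angle sine and cosine, and their derivatives at a zero *)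

(** A class closed under products and differentiation, so that the cofactor of a power of a sine can
    be differentiated any number of times. *)
Inductive trig_alg (R : realType) : (R -> R) -> Prop :=
| TrigCst c : trig_alg (fun=> c)
| TrigCos : trig_alg (fun x => cos (x / 2))
| TrigSin : trig_alg (fun x => sin (x / 2))
| TrigAdd f g : trig_alg f -> trig_alg g -> trig_alg (fun x => f x + g x)
| TrigMul f g : trig_alg f -> trig_alg g -> trig_alg (fun x => f x * g x).

Lemma is_derive_sin_half (R : realType) (r x : R) :
  is_derive x 1 (fun x => sin ((x - r) / 2)) (cos ((x - r) / 2) / 2).
Proof.
apply: is_derive_eq.
by rewrite /GRing.scale /=; field.
Qed.

Lemma is_derive_cos_half (R : realType) (r x : R) :
  is_derive x 1 (fun x => cos ((x - r) / 2)) (- sin ((x - r) / 2) / 2).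
Proof.
apply: is_derive_eq.
by rewrite /GRing.scale /=; field.
Qed.

Lemma trig_alg_derive (R : realType) (f : R -> R) : trig_alg f ->
  exists2 df, trig_alg df & forall x : R, is_derive x 1 f (df x).
Proof.
elim=> {f} [c|||f g _ [df Df fdf] _ [dg Dg gdg]|f g Af [df Df fdf] Ag [dg Dg gdg]].
- by exists (fun=> 0); [exact: TrigCst|move=> x; exact: is_derive_cst].
- exists (fun x : R => - 2^-1 * sin (x / 2)).
    by apply: TrigMul; [exact: TrigCst|exact: TrigSin].
  by move=> x; apply: is_derive_eq; rewrite /GRing.scale /=; field.
- exists (fun x : R => 2^-1 * cos (x / 2)).
    by apply: TrigMul; [exact: TrigCst|exact: TrigCos].
  by move=> x; apply: is_derive_eq; rewrite /GRing.scale /=; field.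
- by exists (fun x => df x + dg x); [exact: TrigAdd|move=> x; exact: is_deriveD].
- exists (fun x => f x * dg x + g x * df x).
    by apply: TrigAdd; apply: TrigMul.
  by move=> x; exact: is_deriveM.
Qed.

Lemma sin_half_shift (R : realType) (r x : R) :
  sin ((x - r) / 2) = cos (r / 2) * sin (x / 2) + - sin (r / 2) * cos (x / 2).
Proof. by rewrite mulrBl sinB; ring. Qed.

Lemma cos_half_shift (R : realType) (r x : R) :
  cos ((x - r) / 2) = cos (r / 2) * cos (x / 2) + sin (r / 2) * sin (x / 2).
Proof. by rewrite mulrBl cosB; ring. Qed.

Lemma trig_alg_sin_half (R : realType) (r : R) :
  trig_alg (fun x => sin ((x - r) / 2)).
Proof.
under eq_fun do rewrite sin_half_shift.
by apply: TrigAdd; apply: TrigMul; constructor.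
Qed.

Lemma trig_alg_exp (R : realType) (f : R -> R) k :
  trig_alg f -> trig_alg (fun x => f x ^+ k).
Proof.
move=> Af; elim: k => [|k IH]; first exact: TrigCst.
under eq_fun do rewrite exprS.
exact: TrigMul.
Qed.

Lemma trig_alg_prod (R : realType) (I : Type) (s : seq I) (P : pred I)
    (f : I -> R -> R) :
  (forall i, trig_alg (f i)) -> trig_alg (fun x => \prod_(i <- s | P i) f i x).
Proof.
move=> Af; elim: s => [|i s IH].
  by under eq_fun do rewrite big_nil; exact: TrigCst.
under eq_fun do rewrite big_cons.
by case: (P i) => //; exact: TrigMul.
Qed.

(** Each differentiation lowers the exponent of the sine by one. The term that differentiates the
    cofactor keeps an extra sine and vanishes at [r]; the other multiplies the value at [r] by
    [(k - i) / 2], whence the falling factorial and the power of 2. *)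
Lemma derive1n_sin_half_exp (R : realType) (r : R) (k i : nat) (f : R -> R) :
  trig_alg f -> (i <= k)%N ->
  exists g, [/\ trig_alg g, g r = (k ^_ i)%:R * 2 ^- i * f r &
    derive1n i (fun x => sin ((x - r) / 2) ^+ k * f x) =
    (fun x => sin ((x - r) / 2) ^+ (k - i) * g x)].
Proof.
move=> Af; elim: i => [_|i IH ik].
  exists f; split=> //; first by rewrite ffactn0 expr0 invr1 !mul1r.
  by rewrite subn0.
have [g [Ag gr fg]] := IH (ltnW ik); have [dg Adg gdg] := trig_alg_derive Ag.
exists (fun x => (k - i)%:R * 2^-1 * cos ((x - r) / 2) * g x
  + sin ((x - r) / 2) * dg x); split.
- apply: TrigAdd; apply: TrigMul => //; last exact: trig_alg_sin_half.
  apply: TrigMul; first exact: TrigCst.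
  under eq_fun do rewrite cos_half_shift.
  by apply: TrigAdd; apply: TrigMul; constructor.
- by rewrite subrr mul0r cos0 sin0 gr mul0r ffactnSr natrM exprS invfM; ring.
- rewrite derive1nS fg; apply/funext => x; rewrite derive1E.
  have -> : (k - i = (k - i.+1).+1)%N by lia.
  set j := (k - i.+1)%N.
  have h1 := is_deriveX j.+1 (is_derive_sin_half r x).
  have h2 := is_deriveM h1 (gdg x).
  have -> : (fun x => sin ((x - r) / 2) ^+ j.+1 * g x) =
      (fun x => sin ((x - r) / 2)) ^+ j.+1 * g by apply/funext => y; rewrite !fctE.
  rewrite (@derive_val _ _ _ _ _ _ _ h2) /GRing.scale /= fctE.
  by rewrite exprS; field.
Qed.

(* The [k]-th derivative at [r] sees only the leading factor:
   it equals [k! / 2 ^ k * f r]. *)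
Lemma derive1n_sin_half_exp_eq0 (R : realType) (r : R) (k : nat) (f : R -> R) :
  trig_alg f -> derive1n k (fun x => sin ((x - r) / 2) ^+ k * f x) r = 0 ->
  f r = 0.
Proof.
move=> Af; have [g [_ gr ->]] := derive1n_sin_half_exp r Af (leqnn k).
rewrite subnn expr0 mul1r gr ffactnn => /eqP.
rewrite !mulf_eq0 invr_eq0 expf_eq0 !pnatr_eq0 andbF orbF.
by rewrite eqn0Ngt fact_gt0 /= => /eqP.
Qed.

(** * Homogeneous half-angle forms and their factorization *)

(* Homogeneous forms of degree [N] in [cos (x / 2)] and [sin (x / 2)]; for
   [N = 2 n] these are the trigonometric polynomials of degree at most [n]. *)
Fixpoint trig_form (R : realType) (N : nat) (f : R -> R) : Prop :=
  if N is N'.+1 then exists g h, [/\ trig_form N' g, trig_form N' h &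
    f = fun x => cos (x / 2) * g x + sin (x / 2) * h x]
  else exists c, f = fun=> c.

Lemma trig_formP (R : realType) N (f g : R -> R) (u v : R) :
  trig_form N f -> trig_form N g -> trig_form N (fun x => u * f x + v * g x).
Proof.
elim: N f g => [|N IH] f g /=.
  by move=> [c ->] [c' ->]; exists (u * c + v * c').
move=> [f1 [f2 [f1N f2N ->]]] [g1 [g2 [g1N g2N ->]]].
exists (fun x => u * f1 x + v * g1 x), (fun x => u * f2 x + v * g2 x).
by split; [exact: IH|exact: IH|apply/funext => x; ring].
Qed.

Lemma trig_formS (R : realType) N (f : R -> R) (u v : R) :
  trig_form N f ->
  trig_form N.+1 (fun x => (u * cos (x / 2) + v * sin (x / 2)) * f x).
Proof.
move=> fN /=; exists (fun x => u * f x + 0 * f x), (fun x => v * f x + 0 * f x).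
by split; [exact: trig_formP|exact: trig_formP|apply/funext => x; ring].
Qed.

Lemma trig_form_alg (R : realType) N (f : R -> R) :
  trig_form N f -> trig_alg f.
Proof.
elim: N f => [|N IH] f /=; first by move=> [c ->]; exact: TrigCst.
move=> [g [h [/IH gA /IH hA ->]]].
by apply: TrigAdd; apply: TrigMul => //; constructor.
Qed.

(** Multiplying by [cos ^ 2 + sin ^ 2 = 1] raises the degree by 2 without changing the function.
    This brings all harmonics of a trigonometric polynomial to one degree. *)
Lemma trig_form_addn (R : realType) N k (f : R -> R) :
  trig_form N f -> trig_form (N + 2 * k) f.
Proof.
move=> fN; elim: k => [|k IH]; first by rewrite addn0.
have -> : (N + 2 * k.+1 = (N + 2 * k).+2)%N by lia.
have := trig_formP 1 1 (trig_formS 1 0 (trig_formS 1 0 IH))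
  (trig_formS 0 1 (trig_formS 0 1 IH)).
congr (trig_form _ _); apply/funext => x.
transitivity ((cos (x / 2) ^+ 2 + sin (x / 2) ^+ 2) * f x); first by ring.
by rewrite cos2Dsin2 mul1r.
Qed.

Lemma trig_form_cossin (R : realType) N :
  trig_form N (fun x : R => cos (N%:R * (x / 2))) /\
  trig_form N (fun x : R => sin (N%:R * (x / 2))).
Proof.
elim: N => [|N [cN sN]].
  by split; [exists 1|exists 0]; apply/funext => x;
    rewrite mul0r ?cos0 ?sin0.
have NS (x : R) : N.+1%:R * (x / 2) = N%:R * (x / 2) + x / 2.
  by rewrite -natr1; ring.
split.
  have := trig_formP 1 (-1) (trig_formS 1 0 cN) (trig_formS 0 1 sN).
  congr (trig_form _ _); apply/funext => x.
  by rewrite NS cosD; ring.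
have := trig_formP 1 1 (trig_formS 1 0 sN) (trig_formS 0 1 cN).
congr (trig_form _ _); apply/funext => x.
by rewrite NS sinD; ring.
Qed.

Lemma trig_form_trigpoly (R : realType) n (a b : nat -> R) :
  trig_form (2 * n) (trigpoly n a b).
Proof.
have cstN N (c : R) : trig_form (2 * N) (fun=> c).
  by rewrite -[(2 * N)%N]add0n; apply: trig_form_addn; exists c.
suff sumN k : (k <= n)%N -> trig_form (2 * n)
    (fun x => \sum_(1 <= l < k.+1) (a l * cos (l%:R * x) + b l * sin (l%:R * x))).
  have := trig_formP 1 1 (cstN n (a 0%N / 2)) (sumN n (leqnn n)).
  by congr (trig_form _ _); apply/funext => x; rewrite !mul1r.
elim: k => [_|k IH kn].
  by under eq_fun do rewrite big_nil; exact: cstN.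
have [ck sk] := trig_form_cossin R (2 * k.+1).
(* The harmonic [k.+1] in [x] is the multiple [2 * k.+1] of [x / 2], hence a form of that degree,
   raised here to [2 * n]. *)
have h := trig_form_addn (n - k.+1) (trig_formP (a k.+1) (b k.+1) ck sk).
rewrite -mulnDr subnKC // in h.
have := trig_formP 1 1 (IH (ltnW kn)) h.
congr (trig_form _ _); apply/funext => x; rewrite [RHS]big_nat_recr //= !mul1r.
have -> // : (2 * k.+1)%:R * (x / 2) = k.+1%:R * x.
by rewrite natrM; field.
Qed.

(** Rotating the coordinates by [r / 2] writes [f] as [cos ((x - r) / 2) * g' + sin ((x - r) / 2) *
    h']. At [r] this reads [g' r = f r = 0], so by induction on the degree [g'] also contains the
    sine factor. *)
Lemma trig_form_root (R : realType) N (f : R -> R) (r : R) :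
  trig_form N.+1 f -> f r = 0 ->
  exists2 g, trig_form N g & f = fun x => sin ((x - r) / 2) * g x.
Proof.
elim: N f => [|N IH] f [g [h [gN hN fE]]] fr.
  have [[u gu] [v hv]] := (gN, hN).
  exists (fun=> cos (r / 2) * v - sin (r / 2) * u); first by eexists.
  have : cos (r / 2) * u + sin (r / 2) * v = 0 by rewrite -fr fE gu hv.
  move=> uv0; apply/funext => x; rewrite fE gu hv sin_half_shift.
  set C := cos (r / 2) in uv0 *; set S := sin (r / 2) in uv0 *.
  have CS : C ^+ 2 + S ^+ 2 = 1 by exact: cos2Dsin2.
  set p := cos (x / 2); set s := sin (x / 2).
  (* Lagrange's identity: the difference equals [(C * s - S * p) * (C * v - S * u)], and its first
     factor is [sin ((x - r) / 2)]. *)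
  transitivity ((C ^+ 2 + S ^+ 2) * (p * u + s * v)
      - (C * u + S * v) * (C * p + S * s)); last by ring.
  by rewrite uv0 CS; ring.
pose g' x := cos (r / 2) * g x + sin (r / 2) * h x.
pose h' x := cos (r / 2) * h x + - sin (r / 2) * g x.
have g'N : trig_form N.+1 g' by exact: trig_formP.
have h'N : trig_form N.+1 h' by exact: trig_formP.
have fE' x : f x = cos ((x - r) / 2) * g' x + sin ((x - r) / 2) * h' x.
  rewrite fE /g' /h' sin_half_shift cos_half_shift.
  set C := cos (r / 2); set S := sin (r / 2).
  have CS : C ^+ 2 + S ^+ 2 = 1 by exact: cos2Dsin2.
  by rewrite -[LHS]mul1r -CS; ring.
have [|k kN g'k] := IH _ g'N; first by rewrite /g' -fr fE.
exists (fun x => 1 * ((cos (r / 2) * cos (x / 2) + sin (r / 2) * sin (x / 2)) * k x)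
  + 1 * h' x).
  by apply: trig_formP => //; exact: trig_formS.
by apply/funext => x; rewrite fE' g'k cos_half_shift; ring.
Qed.

(** After [M] factors have been removed, [beta] records how many came from each root. While [M < N],
    some [beta i] is below [alpha i]; the vanishing derivative of order [beta i] then forces the
    cofactor to vanish at [r i], and one more factor splits off. At [M = N] the cofactor has degree
    0. *)
Lemma trig_form_factor (R : realType) (N m : nat) (r : 'I_m -> R)
    (alpha : 'I_m -> nat) (f : R -> R) :
  trig_form N f ->
  (forall i j, i != j -> sin ((r i - r j) / 2) != 0) ->
  (forall i j, (j < alpha i)%N -> derive1n j f (r i) = 0) ->
  (\sum_(i < m) alpha i = N)%N ->
  exists K, f = fun x => K * \prod_(i < m) sin ((x - r i) / 2) ^+ alpha i.
Proof.
move=> fN sinr0 f0 sumN.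
have peel M : (M <= N)%N -> exists beta g,
    [/\ forall i, (beta i <= alpha i)%N, (\sum_(i < m) beta i = M)%N,
      trig_form (N - M) g &
      f = fun x => \prod_(i < m) sin ((x - r i) / 2) ^+ beta i * g x].
  elim: M => [_|M IH MN].
    exists (fun=> 0%N), f; split=> //.
    - by rewrite big1.
    - by rewrite subn0.
    - by apply/funext => x; rewrite big1 ?mul1r.
  have [beta [g [ba sumb gN fE]]] := IH (ltnW MN).
  have [i bi] : exists i, (beta i < alpha i)%N.
    apply/not_existsP => abN; suff : (N <= M)%N by lia.
    by rewrite -sumN -sumb; apply: leq_sum => i _; rewrite leqNgt; apply/negP.
  (* The factors of the other roots, nonzero at [r i] by the separation hypothesis. *)
  pose P x := \prod_(j < m | j != i) sin ((x - r j) / 2) ^+ beta j.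
  have PA : trig_alg P.
    by apply: trig_alg_prod => j; apply: trig_alg_exp; exact: trig_alg_sin_half.
  have gri : g (r i) = 0.
    have : P (r i) * g (r i) = 0.
      apply: (@derive1n_sin_half_exp_eq0 R (r i) (beta i) (fun x => P x * g x)).
        by apply: TrigMul => //; exact: trig_form_alg gN.
      rewrite -[RHS](f0 i (beta i) bi) fE.
      congr (derive1n _ _ _); apply/funext => x.
      by rewrite (bigD1 i) //= mulrA.
    move=> /eqP; rewrite mulf_eq0 => /orP[|/eqP //].
    rewrite prodf_seq_eq0 => /hasP[j _ /andP[ji]].
    by rewrite expf_eq0 (negPf (sinr0 i j _)) ?andbF // eq_sym.
  have NM : (N - M = (N - M.+1).+1)%N by lia.
  rewrite NM in gN; have [g' g'N gE] := trig_form_root gN gri.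
  exists (fun j => (beta j + (j == i))%N), g'; split=> //.
  - by move=> j; case: eqVneq => [->|_]; rewrite ?addn1 ?addn0.
  - rewrite big_split /= sumb (bigD1 i) //= eqxx big1 ?addn0 ?addn1 //.
    by move=> j /negPf ->.
  - apply/funext => x; rewrite fE gE [in LHS](bigD1 i) //= [in RHS](bigD1 i) //=.
    rewrite eqxx addn1 exprS -/(P x).
    under [in RHS]eq_bigr => j /negPf -> do rewrite addn0.
    by rewrite -/(P x); ring.
have [beta [g [ba sumb gN ->]]] := peel N (leqnn N).
move: gN; rewrite subnn => -[K ->]; exists K; apply/funext => x.
rewrite mulrC; congr (_ * _); apply: eq_bigr => i _; congr (_ ^+ _).
(* The termwise bound [beta <= alpha] together with equal sums forces equality everywhere. *)
apply/eqP; rewrite eqn_leq ba leqNgt /=; apply/negP => bi.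
suff : (\sum_(i < m) beta i < \sum_(i < m) alpha i)%N by rewrite sumb sumN ltnn.
rewrite [ltnLHS](bigD1 i) // [ltnRHS](bigD1 i) //= -addSn leq_add //.
by apply: leq_sum => j _; exact: ba.
Qed.

(** * Logarithmic derivatives and the exact error of one step *)

(** Logarithmic differentiation. The predicate [P] lets the formula serve both for [T], with all
    indices, and for [Qfun], where one is omitted. *)
Lemma is_derive_prod_sin (R : realType) (I : eqType) (s : seq I) (P : pred I)
    (alpha : I -> nat) (y : I -> R) (x : R) :
  (forall j, P j -> sin ((x - y j) / 2) != 0) ->
  is_derive x 1 (fun x => \prod_(j <- s | P j) sin ((x - y j) / 2) ^+ alpha j)
    (\prod_(j <- s | P j) sin ((x - y j) / 2) ^+ alpha j *
     \sum_(j <- s | P j)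
       (alpha j)%:R / 2 * (cos ((x - y j) / 2) / sin ((x - y j) / 2))).
Proof.
move=> s0; elim: s => [|i s IH].
  under eq_fun do rewrite big_nil.
  by rewrite !big_nil mulr0; exact: is_derive_cst.
under eq_fun do rewrite big_cons.
rewrite !big_cons; case: ifPn => // Pi.
have h1 := is_deriveX (alpha i) (is_derive_sin_half (y i) x).
have h2 := is_deriveM h1 IH.
set F := (X in is_derive _ _ X _).
have -> : F = (fun x => sin ((x - y i) / 2)) ^+ alpha i *
    (fun x => \prod_(j <- s | P j) sin ((x - y j) / 2) ^+ alpha j).
  by apply/funext => z; rewrite /F !fctE.
apply: is_derive_eq h2 _; rewrite /GRing.scale /= fctE.
have := s0 _ Pi; case: (alpha i) => [|k] si0 /=.
  by rewrite !expr0; ring.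
by rewrite !exprS; field.
Qed.

(** Isolating the index [i] in [T' / T - Q' / Q] gives [(alpha_i cot (e / 2) + S) / 2], so the new
    error is [e - 2 alpha_i / (alpha_i cot (e / 2) + S)]; multiplying through by [sin (e / 2)]
    removes the cotangent. *)
Lemma iter_step_error (R : realType) (m : nat) (r y : 'I_m -> R)
    (alpha : 'I_m -> nat) (K : R) (i : 'I_m) (T : R -> R) :
  T = (fun x => K * \prod_(j < m) sin ((x - r j) / 2) ^+ alpha j) -> K != 0 ->
  (forall j, sin ((y i - r j) / 2) != 0) ->
  (forall j, j != i -> sin ((y i - y j) / 2) != 0) ->
  let e := y i - r i in
  let S := \sum_(j < m | j != i) (alpha j)%:R *
    (cos ((y i - r j) / 2) / sin ((y i - r j) / 2)
     - cos ((y i - y j) / 2) / sin ((y i - y j) / 2)) in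
  (alpha i)%:R * cos (e / 2) + S * sin (e / 2) != 0 ->
  iter_step T alpha y i - r i =
    ((alpha i)%:R * (e * cos (e / 2) - 2 * sin (e / 2)) + e * S * sin (e / 2))
    / ((alpha i)%:R * cos (e / 2) + S * sin (e / 2)).
Proof.
move=> TE K0 sr0 sy0 e S D0.
have hT := is_deriveM (is_derive_cst K (y i) 1) (is_derive_prod_sin
  (index_enum 'I_m) alpha (fun j (_ : predT j) => sr0 j)).
have hQ := is_derive_prod_sin (index_enum 'I_m) alpha sy0.
have T0 : T (y i) != 0.
  rewrite TE mulf_neq0 // prodf_seq_neq0; apply/allP => j _ /=.
  by rewrite expf_neq0.
have Q0 : Qfun alpha y i (y i) != 0.
  rewrite /Qfun prodf_seq_neq0; apply/allP => j _; apply/implyP => ji.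
  by rewrite expf_neq0 ?sy0.
have dT : derive1 T (y i) = T (y i) * \sum_(j < m)
    (alpha j)%:R / 2 * (cos ((y i - r j) / 2) / sin ((y i - r j) / 2)).
  have -> : T = cst K * (fun x => \prod_(j < m) sin ((x - r j) / 2) ^+ alpha j).
    by rewrite TE.
  by rewrite derive1E (@derive_val _ _ _ _ _ _ _ hT) /GRing.scale /= !fctE; ring.
have dQ : derive1 (Qfun alpha y i) (y i) = Qfun alpha y i (y i) *
    \sum_(j < m | j != i)
      (alpha j)%:R / 2 * (cos ((y i - y j) / 2) / sin ((y i - y j) / 2)).
  by rewrite derive1E (@derive_val _ _ _ _ _ _ _ hQ).
have bracket : derive1 T (y i) -
    T (y i) * (derive1 (Qfun alpha y i) (y i) / Qfun alpha y i (y i)) =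
    T (y i) * (((alpha i)%:R * (cos (e / 2) / sin (e / 2)) + S) / 2).
  rewrite dQ (mulrC (Qfun _ _ _ _)) mulfK // dT (bigD1 i) //= -/e -mulrBr.
  congr (_ * _); rewrite -addrA -sumrB [RHS]mulrDl; congr (_ + _); first by ring.
  by rewrite /S mulr_suml; apply: eq_bigr => j _; ring.
have se0 : sin (e / 2) != 0 := sr0 i.
rewrite /iter_step bracket -/e.
have -> : (alpha i)%:R * (cos (e / 2) / sin (e / 2)) + S =
   ((alpha i)%:R * cos (e / 2) + S * sin (e / 2)) / sin (e / 2).
  by field.
have -> : y i = e + r i by rewrite /e subrK.
by field; rewrite D0 se0 /= /e subrK T0.
Qed.

Lemma cotB (R : realType) (u v : R) : sin u != 0 -> sin v != 0 ->
  cos u / sin u - cos v / sin v = sin (v - u) / (sin u * sin v).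
Proof. by move=> u0 v0; rewrite sinB; field; rewrite u0 v0. Qed.

(** * Cubic convergence by induction on the iteration number *)

Theorem theorem2 (R : realType) (n m : nat) (a b : nat -> R)
  (r : 'I_m -> R) (alpha : 'I_m -> nat) (d c q xi A : R)
  (x : nat -> 'I_m -> R)
  (hlead : a n <> 0 \/ b n <> 0)
  (hm : (2 <= m)%N)
  (hdistinct : injective r)
  (hroots : forall i : 'I_m, root_of_mult (trigpoly n a b) (r i) (alpha i))
  (hsum : (\sum_(i < m) alpha i = 2 * n)%N)
  (hd : d = min_dist r)
  (hc : 0 < c) (hq : 0 < q) (hxi : 0 < xi)
  (hq1 : q < 1) (hcxi : 2 * c < xi) (hdc : 0 < d - 2 * c)
  (hmax : max_dist r < 2 * pi - 2 * xi)
  (hA : A = Num.min `|sin (xi / 2)| `|sin (d / 2 - c)|)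
  (hcond : forall i : 'I_m,
    c ^+ 2 * (4 * n%:R + (alpha i)%:R * (9 * A ^+ 2 / 8 - 2))
      < A ^+ 2 * (alpha i)%:R)
  (hiter : forall (k : nat) (i : 'I_m),
    x k.+1 i = iter_step (trigpoly n a b) alpha (x k) i)
  (hinit : forall i : 'I_m, `|x 0%N i - r i| <= c * q) :
  forall (k : nat) (i : 'I_m), `|x k i - r i| <= c * q ^+ (3 ^ k).
Proof.
have distE i j : i != j -> d <= `|r i - r j| <= max_dist r.
  move=> ij; apply/andP; split.
    by rewrite hd; apply: (bigmin_le_cond _ (fun p : 'I_m * 'I_m =>
      `|r p.1 - r p.2|) (j := (i, j))).
  exact: (le_bigmax_cond _ (fun p : 'I_m * 'I_m => `|r p.1 - r p.2|)
    (j := (i, j))).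
have d_max : d <= max_dist r.
  (* Two indices exist since [2 <= m]. The resulting inequality keeps [xi / 2] and [d / 2 - c] below
     [pi], so both sines defining [A] are positive. *)
  pose i0 := Ordinal (ltnW hm); pose i1 := Ordinal hm.
  by have /andP[] := distE i0 i1 isT; exact: le_trans.
have pi0 := pi_gt0 R.
have sxi : 0 < sin (xi / 2) by apply: sin_gt0_pi; apply/andP; split; lra.
have sdc : 0 < sin (d / 2 - c) by apply: sin_gt0_pi; apply/andP; split; lra.
have A0 : 0 < A by rewrite hA lt_min !normr_gt0 !gt_eqF.
(* This range of [t] covers differences of two roots, of an approximation and a root, and of two
   approximations: errors of at most [c] each shift a difference by at most [2 * c], and
   [2 * c < xi]. *)
have sinA (t : R) : d - 2 * c <= `|t| <= 2 * pi - xi -> A <= `|sin (t / 2)|.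
  move=> /andP[t1 t2].
  have -> : `|sin (t / 2)| = `|sin (`|t| / 2)|.
    have [t0|t0] := leP 0 t; first by rewrite (ger0_norm t0).
    by rewrite (ltr0_norm t0) mulNr sinN normrN.
  apply: le_trans (ler_norm _).
  rewrite hA (gtr0_norm sxi) (gtr0_norm sdc) minC.
  by apply: sin_ge_min; [lra|lra|apply/andP; split; lra].
have r_sep i j : i != j -> sin ((r i - r j) / 2) != 0.
  move=> /distE /andP[? ?]; rewrite -normr_gt0; apply: lt_le_trans A0 _.
  by apply: sinA; apply/andP; split; lra.
have [K TE] := trig_form_factor (trig_form_trigpoly n a b) r_sep
  (fun i j => let: And3 _ z _ := hroots i in z j) hsum.
have K0 : K != 0.
  (* If [K] were 0, all derivatives of [T] would vanish, against the nonzero derivative of order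
     [alpha] at a root. *)
  apply/eqP => K0.
  have [a0 _] := hroots (Ordinal hm); apply; rewrite TE K0.
  suff -> : derive1n (alpha (Ordinal hm)) (fun x => 0 * \prod_(i < m)
    sin ((x - r i) / 2) ^+ alpha i) = fun=> 0 by [].
  under eq_fun do rewrite mul0r.
  elim: (alpha _) => [//|k IH]; rewrite derive1nS IH.
  by apply/funext => z; rewrite derive1E; exact: derive_cst.
elim=> [|k IH] i; first by rewrite expn0 expr1.
set E := c * q ^+ (3 ^ k) in IH.
have E0 : 0 < E by rewrite mulr_gt0 ?exprn_gt0.
have Ec : E <= c by rewrite ger_pMr // exprn_ile1 // ltW.
have -> : c * q ^+ (3 ^ k.+1) = E ^+ 3 / c ^+ 2.
  by rewrite expnSr exprM /E; field; rewrite gt_eqF.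
rewrite hiter; set y := x k in IH *.
have y_sep_r j : j != i -> A <= `|sin ((y i - r j) / 2)|.
  rewrite eq_sym => /distE /andP[d1 d2]; apply: sinA.
  have yr : y i - r j = (r i - r j) + (y i - r i) by ring.
  have h1 := ler_normD (r i - r j) (y i - r i).
  have h2 := ler_normB (y i - r j) (y i - r i).
  have := IH i; rewrite yr in h2 *.
  by rewrite addrK in h2; move=> ?; apply/andP; split; lra.
have y_sep_y j : j != i -> A <= `|sin ((y i - y j) / 2)|.
  rewrite eq_sym => /distE /andP[d1 d2]; apply: sinA.
  have h1 := ler_normD (r i - r j) ((y i - r i) - (y j - r j)).
  have h2 := ler_normB (y i - y j) ((y i - r i) - (y j - r j)).
  have h3 := ler_normB (y i - r i) (y j - r j).
  have e1 : r i - r j + (y i - r i - (y j - r j)) = y i - y j by ring.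
  have e2 : y i - y j - (y i - r i - (y j - r j)) = r i - r j by ring.
  rewrite e1 in h1; rewrite e2 in h2.
  by have := IH i; have := IH j; move=> ? ?; apply/andP; split; lra.
have y_sin_r j : j != i -> sin ((y i - r j) / 2) != 0.
  by move=> /y_sep_r; rewrite -normr_gt0; exact: lt_le_trans.
have y_sin_y j : j != i -> sin ((y i - y j) / 2) != 0.
  by move=> /y_sep_y; rewrite -normr_gt0; exact: lt_le_trans.
have ai0 : (0 < alpha i)%N by have [] := hroots i.
have E3 : 0 <= E ^+ 3 / c ^+ 2 by rewrite divr_ge0 ?exprn_ge0 // ltW.
(* An exact approximation is treated apart, since the error formula divides by [sin (e / 2)]. Here
   [T] vanishes and the step changes nothing, whatever the bracket. *)
have [yri|yri] := eqVneq (y i) (r i).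
  rewrite /iter_step [in (alpha i)%:R * _]TE yri (bigD1 i) //= subrr mul0r sin0.
  by rewrite expr0n gtn_eqF // mul0r mulr0 mulr0 mul0r subr0 subrr normr0.
set e := y i - r i.
have eE : `|e| <= E by exact: IH.
have e0 : e != 0 by rewrite subr_eq0.
have sin_e : sin (e / 2) != 0.
  have : 0 < sin (`|e| / 2).
    by apply: sin_gt0_pi; rewrite divr_gt0 ?normr_gt0 //=; lra.
  have [t0|t0] := leP 0 e; first by rewrite (ger0_norm t0) => /gt_eqF ->.
  by rewrite (ltr0_norm t0) mulNr sinN oppr_gt0 => /lt_eqF ->.
set S := \sum_(j < m | j != i) (alpha j)%:R *
    (cos ((y i - r j) / 2) / sin ((y i - r j) / 2)
     - cos ((y i - y j) / 2) / sin ((y i - y j) / 2)).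
(* The total multiplicity of the other roots; as [2 * n = alpha_i + nu], it turns [hcond] into the
   hypothesis of [step_error_le]. *)
pose nu : R := (\sum_(j < m | j != i) alpha j)%:R.
have nuE : 2 * n%:R = (alpha i)%:R + nu.
  by rewrite -natrM -hsum (bigD1 i) //= natrD.
(* Each cotangent difference is, up to sign, [sin ((y j - r j) / 2)] over a product of two sines of
   modulus at least [A], hence at most [E / (2 * A ^+ 2)] in modulus. *)
have hS : `|S| * (2 * A ^+ 2) <= nu * E.
  rewrite -ler_pdivlMr ?mulr_gt0 ?exprn_gt0 // -mulrA.
  apply: le_trans (ler_norm_sum _ _ _) _.
  rewrite /nu natr_sum mulr_suml; apply: ler_sum => j ji.
  rewrite normrM ger0_norm ?ler0n // ler_wpM2l ?ler0n //.
  rewrite cotB ?y_sin_r ?y_sin_y // normrM normfV normrM.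
  have -> : (y i - y j) / 2 - (y i - r j) / 2 = - ((y j - r j) / 2) by ring.
  rewrite sinN normrN [X in _ <= E * X]invfM [leRHS]mulrA ler_pM //.
  - apply: le_trans (norm_sin_le _) _.
    by rewrite normrM (ger0_norm (_ : 0 <= 2^-1)) // ler_pM2r.
  - rewrite lef_pV2 ?posrE ?mulr_gt0 ?normr_gt0 ?y_sin_r ?y_sin_y ?exprn_gt0 //.
    by rewrite expr2 ler_pM ?y_sep_r ?y_sep_y // ltW.
have half_e : `|e / 2| = `|e| / 2 by rewrite normrM (ger0_norm (_ : 0 <= 2^-1)).
have [D0 le] : 0 < (alpha i)%:R * cos (e / 2) + S * sin (e / 2) /\
  `|((alpha i)%:R * (e * cos (e / 2) - 2 * sin (e / 2)) + e * S * sin (e / 2)) /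
    ((alpha i)%:R * cos (e / 2) + S * sin (e / 2))| <= E ^+ 3 / c ^+ 2.
  apply: (@step_error_le R A c E e (alpha i)%:R nu) => //.
  - by rewrite ltr0n.
  - have -> : 2 * nu + 9 / 8 * (alpha i)%:R * A ^+ 2 =
        4 * n%:R + (alpha i)%:R * (9 * A ^+ 2 / 8 - 2).
      have -> : 4 * n%:R = 2 * ((alpha i)%:R + nu) by rewrite -nuE; ring.
      by field.
    exact: hcond.
  - by rewrite -half_e; exact: norm_sin_le.
  - by apply: le_trans (cos_ge_quad _); rewrite exprMn; lra.
  (* The constant is [2 * (1 / 2) ^ 3 / 3 = 1 / 12]. *)
  - have := norm_sinBcos_le (e / 2); rewrite half_e.
    have -> : e * cos (e / 2) - 2 * sin (e / 2) =
      - (2 * (sin (e / 2) - e / 2 * cos (e / 2))) by field.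
    by rewrite normrN normrM (ger0_norm (_ : 0 <= 2)) // exprMn; lra.
by rewrite (iter_step_error TE K0) ?gt_eqF // => j; have [->|/y_sin_r] := eqVneq j i.
Qed.
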